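(* The norm $\|x\|=|x|+|\mathfrak{d}_0x|$ of $B_0(\mathbb{C}^4)$ is a measurable norm (with respect to the Hilbert space $\mathcal{H}^2(\mathbb{C}^4)$).
   Context: $H^2(\mathbb{C}^4)$ is the real vector space of polynomials with real coefficients in $z=(z_0,z_1,z_2,z_3)$, with inner product $\langle f,g\rangle=\pi^{-4}\int_{\mathbb{C}^4}f\,\overline{g}\,e^{-\sum_{i=0}^3|z_i|^2}\,d\mathrm{Leb}$. For multi-indices $p=(i,j,k,l)\in(\mathbb{N}\cup\{0\})^4$ put $z^p=z_0^iz_1^jz_2^kz_3^l$, $p!=i!j!k!l!$; the $z^p/\sqrt{p!}$ form an orthonormal basis. $\mathcal{H}^2(\mathbb{C}^4)$ is its Hilbert space completion. For $f=\sum_pc_pz^p/\sqrt{p!}$ set $|f|:=\sup_{z\in B(0,1/2)}\sum_p|c_p||z^p|$, where $B(0,1/2)$ is the open ball of radius $1/2$ about $0$ in $\mathbb{C}^4$. $B(\mathbb{C}^4)$ is the completion of $\mathcal{H}^2(\mathbb{C}^4)$ in the norm $|\cdot|$ (a space of holomorphic functions). $\mathfrak{d}_0$ is the linear operator with $\mathfrak{d}_0[z_0^nz_1^jz_2^kz_3^l]=\left(\frac n2z_0^{n-1}-\frac12z_0^{n+1}\right)z_1^jz_2^kz_3^l$, applied termwise to power series. $B_0(\mathbb{C}^4)$ is the closure of $\{x\in B(\mathbb{C}^4):|\mathfrak{d}_0x|<\infty\}$ in the norm $\|x\|=|x|+|\mathfrak{d}_0x|$; $H^2(\mathbb{C}^4)$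 is dense in it. For a Hilbert space $H$, $\theta>0$, an orthogonal projection $P$ of finite rank $l$ on $H$ and a Borel set $F\subseteq PH$, the Gaussian cylinder measure is $\mu_\theta(\{x:Px\in F\})=(\theta/2\pi)^{l/2}\int_Fe^{-\theta|y|^2/2}dy$. A norm $\|\cdot\|$ is measurable (in the sense of Gross) if for every $\epsilon>0$ there is a finite-rank orthogonal projection $P_0$ such that $\mu_\theta\{x\in H:\|Px\|>\epsilon\}<\epsilon$ for every finite-rank orthogonal projection $P$ whose range is orthogonal to that of $P_0$. *)

(* Defs.v *)
From HB Require Import structures.
From mathcomp Require Import all_boot all_order all_algebra.
From mathcomp Require Import all_classical all_reals all_analysis.
From mathcomp Require Import sesquilinear complex.
(* The notations of mpoly clash with those of MathComp-Analysis. *)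
From mathcomp Require mpoly.
Import (coercions,canonicals) mpoly.

Set Implicit Arguments.
Unset Strict Implicit.
Unset Printing Implicit Defensive.

Import Order.TTheory GRing.Theory Num.Theory.
Import numFieldNormedType.Exports.
Import ComplexField.Normc.

Local Open Scope classical_set_scope.
Local Open Scope ring_scope.

Notation mindex := (mpoly.multinom 4).
Notation pol4 R := (mpoly.mpoly 4 R).

(* R^n, with R carrying the Borel sigma-algebra on which MathComp-Analysis
   defines [lebesgue_measure]. *)
Notation Rtuple R n := (n.-tuple (measurableTypeR R)).

Section LebesgueCons.
Context {R : realType}.
Variables (n : nat) (mu : {sigma_finite_measure set (Rtuple R n) -> \bar R}).

Definition cons_tuple (xt : measurableTypeR R * Rtuple R n) : Rtuple R n.+1 :=
  [the Rtuple R n.+1 of xt.1 :: xt.2].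

Definition uncons_tuple (t : Rtuple R n.+1) : measurableTypeR R * Rtuple R n :=
  (tnth t ord0, [tuple of behead t]).

Lemma measurable_cons_tuple : measurable_fun setT cons_tuple.
Proof. exact: (measurable_cons measurable_fst measurable_snd). Qed.

Lemma measurable_uncons_tuple : measurable_fun setT uncons_tuple.
Proof.
by apply: measurable_fun_pair; [exact: measurable_tnth|exact: measurable_behead].
Qed.

Lemma cons_tupleK : cancel cons_tuple uncons_tuple.
Proof.
by move=> [x t]; rewrite /uncons_tuple; congr pair; exact: val_inj.
Qed.

Definition leb_cons : set (Rtuple R n.+1) -> \bar R :=
  pushforward (@lebesgue_measure R \x mu)%E cons_tuple.

Let leb_cons0 : leb_cons set0 = 0%E.
Proof. by rewrite /leb_cons /pushforward preimage_set0 measure0. Qed.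

Let leb_cons_ge0 A : (0 <= leb_cons A)%E.
Proof. exact: (measure_ge0 (@lebesgue_measure R \x mu)%E). Qed.

Let leb_cons_sigma_additive : semi_sigma_additive leb_cons.
Proof.
pose P : {measure set (Rtuple R n.+1) -> \bar R} :=
  measure_function_pushforward__canonical__measure_function_Measure
    (@lebesgue_measure R \x mu)%E measurable_cons_tuple.
exact: (@measure_semi_sigma_additive _ _ _ P).
Qed.

HB.instance Definition _ := isMeasure.Build _ _ _ leb_cons
  leb_cons0 leb_cons_ge0 leb_cons_sigma_additive.

Let sigma_finite_leb_cons : sigma_finite setT leb_cons.
Proof.
have /sigma_finiteP[F [UF ndF Fm]] := sigma_finiteT (@lebesgue_measure R).
have /sigma_finiteP[G [UG ndG Gm]] := sigma_finiteT mu.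
exists (fun k => uncons_tuple @^-1` (F k `*` G k)).
  rewrite -preimage_bigcup -[LHS](preimage_setT uncons_tuple) -setXTT UF UG.
  congr (_ @^-1` _); rewrite predeqE => -[x t]; split.
    move=> [/= [i _ Fx] [j _ Gt]]; exists (maxn i j) => //; split.
      by move: x Fx; exact/subsetPset/ndF/leq_maxl.
    by move: t Gt; exact/subsetPset/ndG/leq_maxr.
  by move=> [i _ []/= ? ?]; split; exists i.
move=> k; have [mF Foo] := Fm k; have [mG Goo] := Gm k; split.
  rewrite -[X in measurable X]setTI; apply: measurable_uncons_tuple => //.
  exact: measurableX.
rewrite /leb_cons /pushforward -comp_preimage.
have -> : uncons_tuple \o cons_tuple = id by exact/funext/cons_tupleK.
rewrite preimage_id.
by rewrite product_measure1E// lte_mul_pinfty// ge0_fin_numE.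
Qed.

HB.instance Definition _ := Measure_isSigmaFinite.Build _ _ _ leb_cons
  sigma_finite_leb_cons.

End LebesgueCons.

(* Lebesgue measure on R^n, along R^(m+1) = R x R^m. *)
Fixpoint leb {R : realType} (n : nat) :
    {sigma_finite_measure set (Rtuple R n) -> \bar R} :=
  match n with
  | 0 => dirac [tuple]
  | m.+1 => leb_cons (leb m)
  end.

Section Fock.
Context {R : realType}.

Definition C4_of_R8 (t : Rtuple R 8) : 'I_4 -> R[i] :=
  fun k => Complex (tnth t (inord k.*2)) (tnth t (inord k.*2.+1)).

Definition enorm (z : 'I_4 -> R[i]) : R :=
  Num.sqrt (\sum_(i < 4) normc (z i) ^+ 2).

Definition peval (f : pol4 R) (z : 'I_4 -> R[i]) : R[i] :=
  mpoly.mmap (real_complex R) z f.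

(* The integral is real because f and g have real coefficients, so it is the
   integral of the real part. *)
Definition fock (f g : pol4 R) : R :=
  pi ^- 4 * \int[leb 8]_(t in setT)
    (complex.Re (peval f (C4_of_R8 t) * conjc (peval g (C4_of_R8 t)))
     * expR (- enorm (C4_of_R8 t) ^+ 2)).

Definition mfact (p : mindex) : nat := \prod_(i < 4) (p i)`!.

Definition fock_basis (p : mindex) : pol4 R :=
  (Num.sqrt (mfact p)%:R)^-1 *: mpoly.mpolyX R p.

(* A power series f = sum_p c_p z^p / sqrt(p!) is represented by the family c.
   The norm |f| is the supremum of sum_p |c_p| |z^p|, without 1 / sqrt(p!). *)

Definition ball_half : set ('I_4 -> R[i]) := [set z | enorm z < 2^-1].

Definition abs_norm (c : mindex -> R) : \bar R :=
  ereal_sup [set (\esum_(p in setT) (`|c p| * normc (mpoly.mmap1 z p))%:E)%E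
            | z in ball_half].

(* mnm_sub is truncated, but its coefficient vanishes when p 0 = 0. *)
Definition d0_monomial (p : mindex) : pol4 R :=
  ((p ord0)%:R / 2) *: mpoly.mpolyX R (mpoly.mnm_sub p (mpoly.mnm1 ord0))
  - 2^-1 *: mpoly.mpolyX R (mpoly.mnm_add p (mpoly.mnm1 ord0)).

(* Termwise application: the coefficient of z^q in
   sum_p (c_p / sqrt(p!)) d0[z^p], a sum with at most two nonzero terms,
   rescaled to the coefficient of z^q / sqrt(q!). *)
Definition d0 (c : mindex -> R) : mindex -> R := fun q =>
  Num.sqrt (mfact q)%:R *
  \sum_(p \in [set: mindex])
    (c p / Num.sqrt (mfact p)%:R * mpoly.mcoeff q (d0_monomial p)).

Definition B0_norm (c : mindex -> R) : \bar R := (abs_norm c + abs_norm (d0 c))%E.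

End Fock.

Section Hilbert.
Context {R : realType} {H : completeNormedModType R}.
Variable dot : {dot H for idfun}.

Definition hilbert : Prop := forall x : H, `|x| ^+ 2 = dot x x.

Definition orthogonal_projection (P : H -> H) : Prop :=
  [/\ linear P, forall x, P (P x) = P x
    & forall x y, dot (P x) y = dot x (P y)].

Definition lincomb (l : nat) (u : 'I_l -> H) (t : Rtuple R l) : H :=
  \sum_(i < l) (tnth t i : R) *: u i.

Definition orthonormal_basis (l : nat) (u : 'I_l -> H) (V : set H) : Prop :=
  (forall i j, dot (u i) (u j) = (i == j)%:R) /\ V = range (lincomb u).

Definition finite_rank (P : H -> H) : Prop :=
  exists (l : nat) (u : 'I_l -> H), orthonormal_basis u (range P).

(* The Gaussian cylinder measure of {x | P x \in F} when u is an orthonormal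
   basis of the range of P; it does not depend on the choice of u. *)
Definition gauss_cylinder (theta : R) (l : nat) (u : 'I_l -> H) (F : set H) :
    \bar R :=
  (((theta / (2 * pi)) `^ (l%:R / 2))%:E *
   \int[leb l]_(t in lincomb u @^-1` F)
     (expR (- theta * `|lincomb u t| ^+ 2 / 2))%:E)%E.

Definition is_norm (N : H -> \bar R) : Prop :=
  [/\ forall x, (0 <= N x < +oo)%E,
      forall x, N x = 0%E -> x = 0,
      forall (a : R) x, N (a *: x) = (`|a|%:E * N x)%E
    & forall x y, (N (x + y)%R <= N x + N y)%E].

Definition measurable_norm (theta : R) (N : H -> \bar R) : Prop :=
  is_norm N /\
  forall eps : R, 0 < eps ->
  exists P0 : H -> H, [/\ orthogonal_projection P0, finite_rank P0
    & forall P : H -> H, orthogonal_projection P ->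
      (forall x y, dot (P x) (P0 y) = 0) ->
      forall (l : nat) (u : 'I_l -> H), orthonormal_basis u (range P) ->
      (gauss_cylinder theta u [set y | eps%:E < N y] < eps%:E)%E].

End Hilbert.

Section FockCompletion.
Context {R : realType} {H : completeNormedModType R}.
Variables (dot : {dot H for idfun}) (iota : {linear pol4 R -> H}).

Definition fock_completion : Prop :=
  [/\ hilbert dot, forall f g, dot (iota f) (iota g) = fock f g
    & dense (range iota)].

(* The c_p such that x = sum_p c_p z^p / sqrt(p!). *)
Definition coefs (x : H) : mindex -> R := fun p => dot x (iota (fock_basis p)).

(* The families with finite [abs_norm] (resp. [B0_norm]) are complete for that
   norm, so the completion B and the closure B0 can be taken among families. *)
Definition in_B (c : mindex -> R) : Prop :=
  forall eps : R, 0 < eps ->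
  exists x : H, (abs_norm (c \- coefs x)%R < eps%:E)%E.

Definition in_B0 (c : mindex -> R) : Prop :=
  forall eps : R, 0 < eps ->
  exists x : mindex -> R, [/\ in_B x, (abs_norm (d0 x) < +oo)%E
    & (B0_norm (c \- x)%R < eps%:E)%E].

End FockCompletion.

(* Main.v *)
Require Import Defs.
From HB Require Import structures.
From mathcomp Require Import all_boot all_order all_algebra.
From mathcomp Require Import all_classical all_reals all_analysis.
From mathcomp Require Import measurable_realfun.
From mathcomp Require Import sesquilinear complex.
From mathcomp Require mpoly.
From mathcomp Require Import ring lra.
Import (coercions,canonicals) mpoly.

Set Implicit Arguments.
Unset Strict Implicit.
Unset Printing Implicit Defensive.

Import Order.TTheory GRing.Theory Num.Theory.
Import numFieldNormedType.Exports.
Import ComplexField.Normc.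

Local Open Scope classical_set_scope.
Local Open Scope ring_scope.

(** Write e_p = z^p / sqrt (p!).  Both halves of the norm are built from
continuous linear functionals: the p-th coefficient of x is <x, e_p>, and the
q-th coefficient of d_0 x is <x, g_q>, where g_q ([d0_vec]) combines the two
neighbours of e_q in the direction z_0 with coefficients at most q_0 + 1.  On
the ball of radius 1/2 one has |z^p| <= 2^-|p|, hence
||x|| <= sum_k |<x, v_k>| for a single countable family v_k ([weighted_vec],
[B0_norm_le]).  This family is absolutely summable ([weighted_vec_summable]):
|e_p| <= 4 (3/2)^|p| follows from (r^2/2)^n / n! <= exp (r^2/2) under the
Gaussian integral ([fock_basis_norm_le]), q_0 + 1 is at most 4 (5/4)^|q|, and
(3/2) (5/4) / 2 = 15/16 < 1.

A functional N bounded by sum_k |<x, v_k>| with sum_k |v_k| finite satisfies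
Gross's condition ([gross_of_summable]).  Take for P_0 the orthogonal
projection onto the span of finitely many v_k, leaving a small tail of
sum_k |v_k|.  On a finite-dimensional space orthogonal to the range of P_0,
only the tail contributes.  There <y, v> is a centred Gaussian variable of
variance at most |v|^2 / theta, by Bessel's inequality, so its first absolute
moment is at most a constant times |v|, the constant depending on theta only
([gauss_abs_dot]); the claim is then Markov's inequality
([gauss_cylinder_markov]).  The absolute moment is controlled by exponential
moments because the exponential of a linear form factors over the coordinates,
so that Tonelli's theorem reduces it to one-dimensional Gaussian integrals
([integral_leb_exp_affine_sqr]). *)

(** * Nonnegative sums and integrals *)

Section Integration.
Context {R : realType}.
Local Open Scope ereal_scope.

(** Nonnegative integrals are suprema over simple functions, so monotonicity
survives when neither D nor f is measurable.  This is how the event that a norm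
exceeds a threshold gets estimated, the norm being a supremum over an
uncountable ball. *)
Lemma ge0_le_integralT d (T : measurableType d)
    (mu : {measure set T -> \bar R}) (D : set T) (f g : T -> \bar R) :
  (forall x, D x -> 0 <= f x) -> (forall x, 0 <= g x) ->
  (forall x, D x -> f x <= g x) ->
  \int[mu]_(x in D) f x <= \int[mu]_x g x.
Proof.
move=> f0 g0 fg.
rewrite integral_mkcond !ge0_integralTE//; last exact: erestrict_ge0.
apply: le_ereal_sup => _ [h /= hf <-]; exists h => // x.
apply: le_trans (hf x) _; rewrite patchE; case: ifPn => //.
by rewrite inE => /fg.
Qed.

(** Unordered sums become series, to which monotone convergence applies. *)
Lemma esum_countType (T : countType) (f : T -> \bar R) :
  (forall p, 0 <= f p) ->
  \esum_(p in [set: T]) f p = \sum_(n <oo) oapp f 0 (pickle_inv n).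
Proof.
move=> f0; rewrite nneseries_esumT; last first.
  by move=> n; case: pickle_inv => //= p.
rewrite [RHS](_ : _ = \esum_(n in range (@pickle T)) oapp f 0 (pickle_inv n)).
  rewrite (esum_image setT).
    by apply: eq_esum => p _; rewrite pickleK_inv.
  by move=> p q _ _; exact: (pcan_inj pickleK).
rewrite [RHS]esum_mkcond; apply: eq_esum => n _.
case: ifPn => // /negP nT.
case E: pickle_inv => [p|//]; exfalso; apply: nT; rewrite inE.
exists p => //; have := @pickle_invK T n; rewrite /ocancel E /=.
exact.
Qed.

Lemma integral_esum d (X : measurableType d)
    (mu : {measure set X -> \bar R}) (T : countType) (f : T -> X -> \bar R) :
  (forall p, measurable_fun setT (f p)) -> (forall p x, 0 <= f p x) ->
  \int[mu]_x (\esum_(p in [set: T]) f p x) =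
  \esum_(p in [set: T]) \int[mu]_x f p x.
Proof.
move=> mf f0; rewrite esum_countType; last by move=> p; exact: integral_ge0.
under eq_integral do rewrite esum_countType//.
rewrite integral_nneseries//; last 2 first.
- move=> n; case: pickle_inv => [p|] //=; exact: measurable_cst.
- by move=> n x _; case: pickle_inv => /=.
apply: eq_eseriesr => n _; case: pickle_inv => [p//|] /=.
by rewrite integral0.
Qed.

Lemma esumZl (T : choiceType) (k : R) (f : T -> \bar R) : (0 <= k)%R ->
  (forall p, 0 <= f p) ->
  \esum_(p in [set: T]) (k%:E * f p) = k%:E * (\esum_(p in [set: T]) f p).
Proof.
move=> k0 f0; rewrite /esum -ereal_supZl//; last first.
  by apply/set0P; exists 0, set0; [exact: fsets_set0|rewrite fsbig_set0].
rewrite image_comp; congr ereal_sup; apply: eq_imagel => F _ /=.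
by rewrite ge0_mule_fsumr.
Qed.

(** Tonelli's theorem, one coordinate at a time along R^(m+1) = R x R^m.  The
one-dimensional integrals are given as real numbers so that their product makes
sense without a product of extended reals. *)
Lemma integral_leb_prod n (g : 'I_n -> R -> R) (c : 'I_n -> R) :
  (forall i, measurable_fun setT (g i)) -> (forall i x, (0 <= g i x)%R) ->
  (forall i, \int[@lebesgue_measure R]_x (g i x)%:E = (c i)%:E) ->
  \int[leb n]_t (\prod_(i < n) g i (tnth t i))%:E = (\prod_(i < n) c i)%:E.
Proof.
elim: n g c => [|n IH] g c mg g0 gc.
  rewrite [leb 0]/= integral_dirac//; last first.
    by apply/measurable_EFinP; under eq_fun do rewrite big_ord0; exact: measurable_cst.
  by rewrite !big_ord0 diracT mul1e.
have mprod m (h : 'I_m -> R -> R) : (forall i, measurable_fun setT (h i)) ->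
    measurable_fun setT (fun t : Rtuple R m => \prod_(i < m) h i (tnth t i))%R.
  move=> mh; apply: measurable_prod => i _.
  apply: (measurableT_comp (mh i)).
  exact: (@measurable_tnth _ (measurableTypeR R) m i).
rewrite [leb n.+1]/=.
rewrite (ge0_integral_pushforward (@measurable_cons_tuple R n))//; last 2 first.
- by apply/measurable_EFinP; exact: (mprod n.+1 g mg).
- by move=> t _; rewrite lee_fin prodr_ge0.
rewrite preimage_setT.
rewrite [LHS](_ : _ = \int[lebesgue_measure \x leb n]_z
   (g ord0 z.1 * \prod_(i < n) g (lift ord0 i) (tnth z.2 i))%:E); last first.
  apply: eq_integral => -[x t] _ /=; congr _%:E.
  rewrite big_ord_recl tnth0; congr (_ * _)%R.
  by apply: eq_bigr => i _; rewrite tnthS.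
rewrite fubini_tonelli1//=; last 2 first.
- apply/measurable_EFinP/measurable_funM.
    exact: (measurableT_comp (mg ord0) measurable_fst).
  by apply: (measurableT_comp (mprod n (fun i => g (lift ord0 i)) _)).
- by move=> z; rewrite lee_fin mulr_ge0// prodr_ge0.
have c0 : (0 <= \prod_(i < n) c (lift ord0 i))%R.
  rewrite prodr_ge0// => i _; rewrite -lee_fin -gc.
  by apply: integral_ge0 => x _; rewrite lee_fin.
transitivity (\int[@lebesgue_measure R]_x
    ((\prod_(i < n) c (lift ord0 i))%:E * (g ord0 x)%:E)); last first.
  rewrite ge0_integralZl//.
  - by rewrite gc big_ord_recl -EFinM mulrC.
  - by apply/measurable_EFinP; exact: mg.
  - by move=> x _; rewrite lee_fin.
apply: eq_integral => x _; rewrite /fubini_F /=.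
rewrite -(IH (fun i => g (lift ord0 i)) (fun i => c (lift ord0 i))
  (fun i => mg _) (fun i => g0 _) (fun i => gc _)).
rewrite muleC -ge0_integralZl//.
- apply/measurable_EFinP; apply: (mprod n (fun i => g (lift ord0 i))) => i.
  exact: mg.
- by move=> t _; rewrite lee_fin; apply: prodr_ge0 => i _; exact: g0.
- by rewrite lee_fin; exact: g0.
Qed.

Local Close Scope ereal_scope.

Lemma esum_tail (T : choiceType) (a : T -> R) (delta : R) :
  0 < delta -> (forall p, 0 <= a p) ->
  (\esum_(p in [set: T]) (a p)%:E < +oo)%E ->
  exists s : seq T,
    (\esum_(p in [set: T]) (if p \in s then 0 else a p)%:E < delta%:E)%E.
Proof.
move=> delta0 a0 afin; set S := (X in (X < _)%E) in afin.
have Sfin : S \is a fin_num.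
  by rewrite ge0_fin_numE// esum_ge0// => p _; rewrite lee_fin.
have /ereal_sup_gt[_ [F [finF _] <-] SF] : (S - delta%:E < S)%E.
  by rewrite lteBlDr// lteDl// lte_fin.
have /finite_seqP[s sF] := finF.
exists s.
have -> : \esum_(p in [set: T]) (if p \in s then 0 else a p)%:E =
    \esum_(p in ~` F) (a p)%:E.
  rewrite [RHS]esum_mkcond; apply: eq_esum => p _.
  by rewrite in_setC sF mem_setE; case: (p \in s).
move: SF; rewrite lteBlDr// /S (esumID F); last by move=> p _; rewrite lee_fin.
rewrite !setTI esum_fset//; last by move=> p _; rewrite lee_fin.
by rewrite lteD2lE// fsumEFin.
Qed.

End Integration.

(** * Exponential moments of the Gaussian measure on R^n *)

Section Gaussian.
Context {R : realType}.
Local Open Scope ereal_scope.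

Lemma measurable_exp_affine_sqr (theta b : R) :
  measurable_fun setT (fun x : R => expR (b * x - theta * x ^+ 2 / 2)).
Proof.
apply: measurableT_comp => //; apply: measurable_funB => //.
apply: measurable_funM => //; apply: measurable_funM => //.
Qed.

(** Completing the square gives the normal density of mean b / theta and
variance 1 / theta. *)
Lemma integral_exp_affine_sqr (theta b : R) : (0 < theta)%R ->
  \int[@lebesgue_measure R]_x (expR (b * x - theta * x ^+ 2 / 2))%:E =
  (expR (b ^+ 2 / (2 * theta)) / (Num.sqrt (theta / (2 * pi))))%:E.
Proof.
move=> theta0.
pose s : R := (Num.sqrt theta)^-1%R.
have s0 : (s != 0)%R by rewrite invr_neq0// gt_eqF// sqrtr_gt0.
have s2 : (s ^+ 2 = theta^-1)%R by rewrite /s exprVn sqr_sqrtr// ltW.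
have tn0 : (theta != 0)%R by rewrite gt_eqF.
have c0 : (0 < Num.sqrt (theta / (2 * pi)) :> R)%R.
  by rewrite sqrtr_gt0 divr_gt0// mulr_gt0// pi_gt0.
have peakE : normal_peak s = Num.sqrt (theta / (2 * pi)).
  rewrite /normal_peak s2 -sqrtrV; last first.
    by rewrite mulrn_wge0// mulr_ge0 ?pi_ge0// invr_ge0 ltW.
  congr Num.sqrt; rewrite -mulr_natr.
  have := pi_gt0 R; move: (@pi R) => p p0; field.
  by rewrite tn0 gt_eqF.
rewrite [LHS](_ : _ = \int[@lebesgue_measure R]_x
   ((expR (b ^+ 2 / (2 * theta)) / (Num.sqrt (theta / (2 * pi))))%:E *
    (normal_pdf (b / theta) s x)%:E)); last first.
  apply: eq_integral => x _; rewrite -EFinM; congr EFin.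
  rewrite normal_pdfE//= peakE /normal_fun.
  rewrite [RHS]mulrA divfK ?gt_eqF// -expRD; congr expR.
  rewrite s2; field.
  by rewrite tn0.
rewrite ge0_integralZl//.
- by rewrite integral_normal_pdf mule1.
- by apply/measurable_EFinP; exact: measurable_normal_pdf.
- by move=> x _; rewrite lee_fin normal_pdf_ge0.
Qed.

(** The moment generating function of the centred Gaussian law of covariance
1 / theta on R^n. *)
Lemma integral_leb_exp_affine_sqr n (theta : R) (b : 'I_n -> R) :
  (0 < theta)%R ->
  ((theta / (2 * pi)) `^ (n%:R / 2))%:E *
  (\int[leb n]_t (expR (\sum_(i < n)
     (b i * tnth t i - theta * (tnth t i : R) ^+ 2 / 2)))%:E) =
  (expR ((\sum_(i < n) b i ^+ 2) / (2 * theta)))%:E.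
Proof.
move=> theta0.
have c0 : (0 < theta / (2 * pi) :> R)%R by rewrite divr_gt0// mulr_gt0// pi_gt0.
have := @integral_leb_prod R n (fun i x => expR (b i * x - theta * x ^+ 2 / 2))
  (fun i => expR (b i ^+ 2 / (2 * theta)) / (Num.sqrt (theta / (2 * pi))))%R
  (fun i => measurable_exp_affine_sqr theta (b i)) (fun i x => expR_ge0 _)
  (fun i => integral_exp_affine_sqr (b i) theta0).
under eq_integral do rewrite -expR_sum.
move=> ->; rewrite -EFinM; congr EFin.
have -> : ((theta / (2 * pi)) `^ (n%:R / 2) =
    Num.sqrt (theta / (2 * pi)) ^+ n)%R.
  by rewrite -powR12_sqrt ?(ltW c0)// -powR_mulrn ?powR_ge0// -powRrM [in RHS](mulrC 2^-1%R).
rewrite big_split/= -expR_sum -mulr_suml mulrCA prodr_const card_ord exprVn.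
by rewrite mulfV ?mulr1// expf_neq0// gt_eqF// sqrtr_gt0.
Qed.

End Gaussian.

(** * Finite orthonormal families *)

Section Hilbert.
Context {R : realType} {H : completeNormedModType R} (dot : {dot H for idfun}).
Hypothesis hilb : hilbert dot.

Definition orthonormal_family l (u : 'I_l -> H) : Prop :=
  forall i j, dot (u i) (u j) = (i == j)%:R.

Definition coords l (u : 'I_l -> H) (x : H) : Rtuple R l :=
  [tuple dot x (u i) | i < l].

Lemma dotC x y : dot x y = dot y x.
Proof. by rewrite hermC expr0 mul1r. Qed.

Lemma dotBl x y z : dot (x - y) z = dot x z - dot y z.
Proof. exact: linearBl. Qed.

Lemma dotBr x y z : dot x (y - z) = dot x y - dot x z.
Proof. exact: linearBr. Qed.

Lemma dotZl (a : R) x y : dot (a *: x) y = a * dot x y.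
Proof. exact: linearZl_LR. Qed.

Lemma dotZr (a : R) x y : dot x (a *: y) = a * dot x y.
Proof. exact: linearZr_LR. Qed.

Lemma dotDl x y z : dot (x + y) z = dot x z + dot y z.
Proof. exact: linearDl. Qed.

Lemma dot_lincombl l (u : 'I_l -> H) (t : Rtuple R l) y :
  dot (lincomb u t) y = \sum_(i < l) (tnth t i : R) * dot (u i) y.
Proof.
by rewrite linear_sumlz; apply: eq_bigr => i _; rewrite linearZl_LR.
Qed.

Lemma lincomb_coordK l (u : 'I_l -> H) (t : Rtuple R l) j : orthonormal_family u ->
  dot (lincomb u t) (u j) = tnth t j.
Proof.
move=> ou; rewrite dot_lincombl (bigD1 j)//= ou eqxx mulr1 big1 ?addr0//.
by move=> i /negbTE ij; rewrite ou ij mulr0.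
Qed.

Lemma norm_lincomb l (u : 'I_l -> H) (t : Rtuple R l) : orthonormal_family u ->
  `|lincomb u t| ^+ 2 = \sum_(i < l) (tnth t i : R) ^+ 2.
Proof.
move=> ou; rewrite hilb dot_lincombl; apply: eq_bigr => i _.
by rewrite dotC lincomb_coordK// expr2.
Qed.

(** The difference of the two sides is the squared distance from x to its
projection. *)
Lemma bessel l (u : 'I_l -> H) x : orthonormal_family u ->
  \sum_(i < l) dot (u i) x ^+ 2 <= `|x| ^+ 2.
Proof.
move=> ou; rewrite -subr_ge0.
suff -> : `|x| ^+ 2 - \sum_(i < l) dot (u i) x ^+ 2 =
    `|x - lincomb u (coords u x)| ^+ 2 by exact: sqr_ge0.
have E : dot (lincomb u (coords u x)) x = \sum_(i < l) dot (u i) x ^+ 2.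
  by rewrite dot_lincombl; apply: eq_bigr => i _; rewrite tnth_mktuple dotC expr2.
rewrite [RHS]hilb dotBl !dotBr -!hilb (dotC x) E norm_lincomb//.
have -> : \sum_(i < l) (tnth (coords u x) i : R) ^+ 2 =
    \sum_(i < l) dot (u i) x ^+ 2.
  by apply: eq_bigr => i _; rewrite tnth_mktuple dotC.
by rewrite subrr subr0.
Qed.

(** Bessel's inequality for the single unit vector x / |x|. *)
Lemma cauchy_schwarz x y : `|dot x y| <= `|x| * `|y|.
Proof.
have [->|x0] := eqVneq x 0.
  by rewrite linear0l normr0 mulr_ge0// ?normr_ge0.
have nx0 : 0 < `|x| by rewrite normr_gt0.
pose u (_ : 'I_1) := `|x|^-1 *: x.
have ou : orthonormal_family u.
  move=> i j; rewrite !ord1 eqxx dotZl dotZr -hilb.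
  by rewrite mulrA -expr2 -exprMn mulVf ?expr1n// gt_eqF.
have := bessel y ou; rewrite big_ord1 dotZl.
rewrite -ler_sqrt ?sqr_ge0// !sqrtr_sqr normrM normfV !normr_id.
by rewrite mulrC ler_pdivrMr// mulrC.
Qed.

(** The list may be linearly dependent: a vector whose residual vanishes
contributes no new direction. *)
Lemma gram_schmidt (s : seq H) : exists (l : nat) (u : 'I_l -> H),
  orthonormal_family u /\ {in s, forall v, range (lincomb u) v}.
Proof.
elim: s => [|v s [l [u [ou us]]]].
  by exists 0, (fun=> 0); split=> // -[].
pose w := v - lincomb u (coords u v).
have vE : v = w + lincomb u (coords u v) by rewrite subrK.
have [w0|w0] := eqVneq w 0.
  exists l, u; split=> // x; rewrite inE => /predU1P[->|]; last exact: us.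
  by exists (coords u v) => //; rewrite [RHS]vE w0 add0r.
have nw0 : `|w| != 0 by rewrite normr_eq0.
pose u' (i : 'I_l.+1) := if unlift ord0 i is Some j then u j else `|w|^-1 *: w.
have u'0 : u' ord0 = `|w|^-1 *: w by rewrite /u' unlift_none.
have u'S j : u' (lift ord0 j) = u j by rewrite /u' liftK.
have wu j : dot w (u j) = 0.
  by rewrite dotBl lincomb_coordK// tnth_mktuple subrr.
have E (a : R) (t : Rtuple R l) :
    lincomb u' (Defs.cons_tuple (a, t)) = a *: u' ord0 + lincomb u t.
  rewrite /lincomb big_ord_recl; congr (_ + _).
  by apply: eq_bigr => i _; rewrite u'S tnthS.
exists l.+1, u'; split.
  move=> i j; case: (unliftP ord0 i) => [i' ->|->];
    case: (unliftP ord0 j) => [j' ->|->]; rewrite ?u'S ?u'0.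
  - by rewrite ou (inj_eq lift_inj).
  - by rewrite dotZr dotC wu mulr0 eq_sym (negbTE (neq_lift _ _)).
  - by rewrite dotZl wu mulr0 (negbTE (neq_lift _ _)).
  - rewrite dotZl dotZr -hilb eqxx.
    by rewrite mulrA -expr2 -exprMn mulVf ?expr1n.
move=> x; rewrite inE => /predU1P[->|/us[t _ <-]].
  exists (Defs.cons_tuple (`|w|, coords u v)) => //.
  by rewrite E u'0 scalerA mulfV// scale1r -vE.
by exists (Defs.cons_tuple (0, t)) => //; rewrite E scale0r add0r.
Qed.

Definition span_proj l (u : 'I_l -> H) (x : H) : H := lincomb u (coords u x).

Lemma span_projK l (u : 'I_l -> H) t : orthonormal_family u ->
  span_proj u (lincomb u t) = lincomb u t.
Proof.
move=> ou; congr (lincomb u _); apply: eq_from_tnth => i.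
by rewrite tnth_mktuple lincomb_coordK.
Qed.

Lemma range_span_proj l (u : 'I_l -> H) : orthonormal_family u ->
  range (span_proj u) = range (lincomb u).
Proof.
move=> ou; apply/seteqP; split=> [_ [x _ <-]|_ [t _ <-]].
  by exists (coords u x).
by exists (lincomb u t) => //; rewrite span_projK.
Qed.

Lemma span_proj_orthogonal l (u : 'I_l -> H) : orthonormal_family u ->
  orthogonal_projection dot (span_proj u).
Proof.
move=> ou; split.
- move=> a x y; rewrite /span_proj /lincomb scaler_sumr -big_split/=.
  apply: eq_bigr => i _; rewrite !tnth_mktuple dotDl dotZl scalerDl scalerA.
  by [].
- by move=> x; rewrite {2}/span_proj span_projK.
- move=> x y; rewrite /span_proj [RHS]dotC !dot_lincombl.
  by apply: eq_bigr => i _; rewrite !tnth_mktuple (dotC x) (dotC y) mulrC.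
Qed.

End Hilbert.

(** * Gross's condition for norms dominated by summable functionals *)

Section Gross.
Context {R : realType} {H : completeNormedModType R} (dot : {dot H for idfun}).
Hypothesis hilb : hilbert dot.
Variable theta : R.
Hypothesis theta0 : 0 < theta.

Let gauss l (u : 'I_l -> H) (t : Rtuple R l) : R :=
  expR (- theta * `|lincomb u t| ^+ 2 / 2).

Let cst_gauss l : R := (theta / (2 * pi)) `^ (l%:R / 2).

Let measurable_dot_lincomb l (u : 'I_l -> H) y :
  measurable_fun setT (fun t : Rtuple R l => dot (lincomb u t) y).
Proof.
under eq_fun do rewrite dot_lincombl.
apply: measurable_sum => i; apply: measurable_funM => //.
exact: (@measurable_tnth _ (measurableTypeR R) l i).
Qed.

Let gaussE l (u : 'I_l -> H) (t : Rtuple R l) : orthonormal_family dot u ->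
  gauss u t = expR (- (theta * (\sum_(i < l) (tnth t i : R) ^+ 2) / 2)).
Proof. by move=> ou; rewrite /gauss (norm_lincomb hilb)// !mulNr. Qed.

Let measurable_gauss l (u : 'I_l -> H) : orthonormal_family dot u ->
  measurable_fun setT (gauss u).
Proof.
move=> ou; rewrite (funext (fun t => gaussE t ou)).
apply: measurableT_comp => //; apply: measurableT_comp => //.
apply: measurable_funM => //; apply: measurable_funM => //.
apply: measurable_sum => i; apply: measurable_funX.
exact: (@measurable_tnth _ (measurableTypeR R) l i).
Qed.

Lemma gauss_mgf l (u : 'I_l -> H) w : orthonormal_family dot u ->
  ((cst_gauss l)%:E *
   \int[leb l]_t (expR (dot (lincomb u t) w) * gauss u t)%:E =
   (expR ((\sum_(i < l) dot (u i) w ^+ 2) / (2 * theta)))%:E)%E.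
Proof.
move=> ou; rewrite -integral_leb_exp_affine_sqr//; congr (_ * _)%E.
apply: eq_integral => t _; congr EFin.
rewrite gaussE// -expRD; congr expR.
rewrite dot_lincombl mulr_sumr mulr_suml -sumrB.
by apply: eq_bigr => i _; rewrite mulrC.
Qed.

(** For w = v / |v| one has |<y, v>| <= |v| (exp <y, w> + exp (- <y, w>)), and
both exponential moments are at most exp (1 / (2 theta)) since Bessel's
inequality bounds the variance of <y, w> by 1 / theta. *)
Lemma gauss_abs_dot l (u : 'I_l -> H) v : orthonormal_family dot u ->
  ((cst_gauss l)%:E *
   \int[leb l]_t (`|dot (lincomb u t) v| * gauss u t)%:E <=
   (2 * expR (2 * theta)^-1 * `|v|)%:E)%E.
Proof.
move=> ou; have [->|v0] := eqVneq v 0.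
  rewrite integral0_eq ?mule0 ?normr0 ?mulr0// => t _.
  by rewrite linear0r normr0 mul0r.
have nv0 : 0 < `|v| by rewrite normr_gt0.
have nvN0 : `|v| != 0 by rewrite gt_eqF.
have mgf_le1 w : `|w| <= 1 -> ((cst_gauss l)%:E *
     \int[leb l]_t (expR (dot (lincomb u t) w) * gauss u t)%:E <=
     (expR (2 * theta)^-1)%:E)%E.
  move=> w1; rewrite gauss_mgf// lee_fin ler_expR -[leRHS]mul1r.
  rewrite ler_wpM2r ?invr_ge0 ?mulr_ge0 ?(ltW theta0)//.
  by apply: le_trans (bessel hilb _ ou) _; rewrite expr_le1.
pose w := `|v|^-1 *: v.
have w1 : `|w| = 1 by rewrite normrZ normfV normr_id mulVf.
have mexp z : measurable_fun setT (fun t : Rtuple R l =>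
    (expR (dot (lincomb u t) z) * gauss u t)%:E).
  apply/measurable_EFinP/measurable_funM; last exact: measurable_gauss.
  by apply: measurableT_comp => //; exact: measurable_dot_lincomb.
have exp0 z t : (0 <= (expR (dot (lincomb u t) z) * gauss u t)%:E)%E.
  by rewrite lee_fin mulr_ge0 ?expR_ge0.
apply: (@le_trans _ _ ((cst_gauss l)%:E * \int[leb l]_t (`|v|%:E *
   ((expR (dot (lincomb u t) w) * gauss u t)%:E +
    (expR (dot (lincomb u t) (- w)) * gauss u t)%:E)))%E).
  apply: lee_wpmul2l; first by rewrite lee_fin powR_ge0.
  apply: ge0_le_integralT => [t _|t|t _].
  - by rewrite lee_fin mulr_ge0 ?expR_ge0.
  - by apply: mule_ge0; [rewrite lee_fin|exact: adde_ge0].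
  rewrite -EFinD -EFinM lee_fin -mulrDl mulrA ler_wpM2r ?expR_ge0//.
  have -> : `|dot (lincomb u t) v| = `|v| * `|dot (lincomb u t) w|.
    by rewrite dotZr normrM normfV normr_id mulrA mulfV// mul1r.
  rewrite ler_wpM2l//.
  have -> : dot (lincomb u t) (- w) = - dot (lincomb u t) w by exact: linearNr.
  move: (dot _ w) => s.
  have := expR_ge1Dx s; have := expR_ge1Dx (- s).
  have := expR_ge0 s; have := expR_ge0 (- s).
  by rewrite ler_norml => *; apply/andP; split; lra.
rewrite ge0_integralZl//; last 2 first.
- by apply: emeasurable_funD.
- by move=> t _; rewrite adde_ge0.
rewrite ge0_integralD// muleCA ge0_muleDr ?integral_ge0//.
rewrite (mulrC _ `|v|) EFinM; apply: lee_wpmul2l; first by rewrite lee_fin.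
rewrite (_ : 2 * _ = expR (2 * theta)^-1 + expR (2 * theta)^-1); last by ring.
by rewrite EFinD; apply: leeD; apply: mgf_le1; rewrite ?normrN w1.
Qed.

(** Markov's inequality for the majorant of N, whose expectation is computed
term by term. *)
Lemma gauss_cylinder_markov (T : countType) (v : T -> H) (N : H -> \bar R)
    (eps : R) l (u : 'I_l -> H) : 0 < eps -> orthonormal_family dot u ->
  (forall t, (N (lincomb u t) <=
     \esum_(p in [set: T]) (`|dot (lincomb u t) (v p)|)%:E)%E) ->
  (gauss_cylinder theta u [set y | eps%:E < N y]%E <=
   (eps^-1 * (2 * expR (2 * theta)^-1))%:E *
   \esum_(p in [set: T]) (`|v p|)%:E)%E.
Proof.
move=> eps0 ou Nle; rewrite /gauss_cylinder -/(cst_gauss l).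
have c0 : 0 <= cst_gauss l by rewrite powR_ge0.
have ieps0 : 0 <= eps^-1 by rewrite invr_ge0 ltW.
have mterm p : measurable_fun setT (fun t : Rtuple R l =>
    (`|dot (lincomb u t) (v p)| * gauss u t)%:E).
  apply/measurable_EFinP/measurable_funM; last exact: measurable_gauss.
  by apply: measurableT_comp => //; exact: measurable_dot_lincomb.
have term0 p (t : Rtuple R l) :
    (0 <= (`|dot (lincomb u t) (v p)| * gauss u t)%:E)%E.
  by rewrite lee_fin mulr_ge0 ?expR_ge0.
apply: (@le_trans _ _ ((cst_gauss l)%:E * \int[leb l]_t
    (\esum_(p in [set: T])
       (eps^-1%:E * (`|dot (lincomb u t) (v p)| * gauss u t)%:E)))%E).
  apply: lee_wpmul2l; first by rewrite lee_fin.
  apply: ge0_le_integralT => [t _|t|t /= tN].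
  - by rewrite lee_fin expR_ge0.
  - by apply: esum_ge0 => p _; rewrite mule_ge0.
  have E p : (eps^-1%:E * (`|dot (lincomb u t) (v p)| * gauss u t)%:E =
      (eps^-1 * gauss u t)%:E * (`|dot (lincomb u t) (v p)|)%:E)%E.
    by rewrite -!EFinM; congr EFin; ring.
  under eq_esum do rewrite E.
  rewrite esumZl ?mulr_ge0 ?expR_ge0//.
  have eN := le_trans (ltW tN) (Nle t).
  apply: le_trans (lee_wpmul2l _ eN); last by rewrite lee_fin mulr_ge0 ?expR_ge0.
  by rewrite -EFinM lee_fin [leRHS]mulrAC mulVf ?mul1r// gt_eqF.
rewrite integral_esum; last 2 first.
- by move=> p; exact: measurable_funeM.
- by move=> p t; rewrite mule_ge0.
rewrite -esumZl//; last first.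
  by move=> p; apply: integral_ge0 => t _; rewrite mule_ge0.
rewrite -esumZl//; last by rewrite mulr_ge0// mulr_ge0 ?expR_ge0.
apply: le_esum => p _; rewrite ge0_integralZl// muleCA -EFinM -mulrA EFinM.
by apply: lee_wpmul2l; [rewrite lee_fin|exact: gauss_abs_dot].
Qed.

(** The finitely many v p that carry all but a small part of the sum of the
norms are put in the range of P0; they are orthogonal to the range of P, so the
majorant of N loses these terms there and Markov's inequality applies to the
rest. *)
Lemma gross_of_summable (T : countType) (v : T -> H) (N : H -> \bar R) :
  (\esum_(p in [set: T]) (`|v p|)%:E < +oo)%E ->
  (forall x, (N x <= \esum_(p in [set: T]) (`|dot x (v p)|)%:E)%E) ->
  forall eps : R, 0 < eps ->
  exists P0 : H -> H, [/\ orthogonal_projection dot P0, finite_rank dot P0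
    & forall P : H -> H, orthogonal_projection dot P ->
      (forall x y, dot (P x) (P0 y) = 0) ->
      forall (l : nat) (u : 'I_l -> H), orthonormal_basis dot u (range P) ->
      (gauss_cylinder theta u [set y | eps%:E < N y]%E < eps%:E)%E].
Proof.
move=> vfin Nle eps eps0.
pose K : R := 2 * expR (2 * theta)^-1.
have K0 : 0 < K by rewrite mulr_gt0// expR_gt0.
(* Markov's inequality loses a factor K / eps. *)
have [s stail] := esum_tail (divr_gt0 (mulr_gt0 eps0 eps0) K0)
  (fun p => normr_ge0 (v p)) vfin.
have [l0 [u0 [ou0 su0]]] := gram_schmidt hilb (map v s).
exists (span_proj dot u0); split.
- exact: span_proj_orthogonal.
- by exists l0, u0; split => //; rewrite range_span_proj.
move=> P _ PP0 l u [ou rPu].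
pose v' p := if p \in s then 0 else v p.
have Nle' (t : Rtuple R l) : (N (lincomb u t) <=
    \esum_(p in [set: T]) (`|dot (lincomb u t) (v' p)|)%:E)%E.
  apply: le_trans (Nle _) _; apply: le_esum => p _; rewrite /v' lee_fin.
  case: ifPn => // ps.
  have [t0 _ <-] := su0 _ (map_f v ps).
  have [x _ <-] : range P (lincomb u t) by rewrite rPu; exists t.
  by rewrite -(span_projK t0 ou0) PP0 normr0.
apply: le_lt_trans (gauss_cylinder_markov eps0 ou Nle') _.
have -> : \esum_(p in [set: T]) (`|v' p|)%:E =
    \esum_(p in [set: T]) (if p \in s then 0 else `|v p|)%:E.
  by apply: eq_esum => p _; rewrite /v'; case: ifP; rewrite ?normr0.
have -> : eps%:E = ((eps^-1 * K)%:E * (eps * eps / K)%:E)%E.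
  by rewrite -EFinM; congr EFin; field; rewrite !gt_eqF.
by rewrite lte_pmul2l// lte_fin mulr_gt0// invr_gt0.
Qed.

End Gross.

(** * Growth of the monomials in the Fock norm *)

Section Monomials.
Context {R : realType}.
Implicit Types (p q : mindex) (z : 'I_4 -> R[i]).

Lemma normc_ge0 (w : R[i]) : 0 <= normc w.
Proof. by case: w => a b /=; exact: sqrtr_ge0. Qed.

Lemma normc_mmap1 z p : normc (mpoly.mmap1 z p) = \prod_(i < 4) normc (z i) ^+ p i.
Proof.
rewrite /mpoly.mmap1 (big_morph _ (@normcM R) (@normc1 R)).
apply: eq_bigr => i _; elim: (p i) => [|k IH]; first by rewrite !expr0 normc1.
by rewrite !exprS normcM IH.
Qed.

Lemma mdegX n (r : R) (p : mpoly.multinom n) :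
  r ^+ mpoly.mdeg p = \prod_(i < n) r ^+ p i.
Proof.
rewrite mpoly.mdegE; elim/big_rec2: _ => [|i y1 y2 _ <-]; first by rewrite expr0.
by rewrite exprD.
Qed.

Lemma Re_mulconjc (w : R[i]) : complex.Re (w * conjc w) = normc w ^+ 2.
Proof.
case: w => a b /=; rewrite sqr_sqrtr ?addr_ge0 ?sqr_ge0//.
by rewrite mulrN opprK !expr2.
Qed.

Lemma normc_peval_fock_basis z p : normc (peval (fock_basis p) z) ^+ 2 =
  \prod_(i < 4) ((normc (z i) ^+ 2) ^+ p i / (p i)`!%:R).
Proof.
rewrite /peval /fock_basis mpoly.mmapZ mpoly.mmapX normcM exprMn normc_mmap1.
rewrite [normc _](_ : _ = (Num.sqrt (mfact p)%:R)^-1); last first.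
  by rewrite /= expr0n /= addr0 sqrtr_sqr ger0_norm// invr_ge0 sqrtr_ge0.
rewrite exprVn sqr_sqrtr// mulrC big_split/= /mfact natr_prod; congr (_ * _).
  by rewrite -prodrXl; apply: eq_bigr => i _; rewrite exprAC.
by rewrite -prodfV.
Qed.

Lemma exprn_div_fact_le (x : R) n : 0 <= x -> x ^+ n / n`!%:R <= expR x.
Proof.
move=> x0; case: n => [|n].
  by rewrite expr0 fact0 divr1 -[leLHS]expR0 ler_expR.
by apply: le_trans (expR_ge1Dxn n x0); rewrite lerDr.
Qed.

(** In each variable, half of the Gaussian weight pays for the monomial:
(r^2 / 2)^n / n! <= exp (r^2 / 2). *)
Lemma normc_peval_fock_basis_le z p :
  normc (peval (fock_basis p) z) ^+ 2 * expR (- enorm z ^+ 2) <=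
  2 ^+ mpoly.mdeg p * expR (- (enorm z ^+ 2 / 2)).
Proof.
have z0 : 0 <= \sum_(i < 4) normc (z i) ^+ 2.
  by apply: sumr_ge0 => i _; exact: sqr_ge0.
have -> : - enorm z ^+ 2 = - (enorm z ^+ 2 / 2) + - (enorm z ^+ 2 / 2) :> R.
  by field.
rewrite expRD mulrA ler_wpM2r ?expR_ge0// expRN ler_pdivrMr ?expR_gt0//.
rewrite /enorm sqr_sqrtr// normc_peval_fock_basis mdegX mulr_suml expR_sum.
rewrite -big_split/=; apply: ler_prod => i _.
rewrite divr_ge0 ?exprn_ge0 ?normc_ge0//=.
have two0 : 2 != 0 :> R by rewrite pnatr_eq0.
rewrite -[in leLHS](divfK two0 (normc (z i) ^+ 2)) exprMn mulrAC mulrC.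
by rewrite ler_wpM2l ?exprn_ge0// exprn_div_fact_le// divr_ge0// sqr_ge0.
Qed.

Lemma enorm_C4_of_R8 (t : Rtuple R 8) :
  enorm (C4_of_R8 t) ^+ 2 = \sum_(j < 8) (tnth t j : R) ^+ 2.
Proof.
rewrite /enorm sqr_sqrtr; last by apply: sumr_ge0 => i _; exact: sqr_ge0.
have -> : \sum_(j < 8) (tnth t j : R) ^+ 2 =
    \sum_(0 <= k < 8) (tnth t (inord k) : R) ^+ 2.
  by rewrite big_mkord; apply: eq_bigr => j _; rewrite inord_val.
have -> : \sum_(i < 4) normc (C4_of_R8 t i) ^+ 2 =
    \sum_(0 <= k < 4) ((tnth t (inord k.*2) : R) ^+ 2 +
                       (tnth t (inord k.*2.+1) : R) ^+ 2).
  rewrite big_mkord; apply: eq_bigr => i _.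
  by rewrite /= sqr_sqrtr// addr_ge0 ?sqr_ge0.
by rewrite unlock /= !addr0 !addrA.
Qed.

Lemma integral_leb8_gauss :
  (\int[leb 8]_t (expR (- (enorm (C4_of_R8 t) ^+ 2 / 2)))%:E =
   ((2 * pi) ^+ 4 : R)%:E)%E.
Proof.
have pi0 : 0 < 2 * pi :> R by rewrite mulr_gt0// pi_gt0.
have := @integral_leb_exp_affine_sqr R 8 1 (fun=> 0) ltr01.
under eq_integral => t _.
  rewrite sumrB big1 ?sub0r; last by move=> i _; rewrite mul0r.
  rewrite [X in - X](_ : _ = enorm (C4_of_R8 t) ^+ 2 / 2); last first.
    by rewrite enorm_C4_of_R8 mulr_suml; apply: eq_bigr => i _; rewrite mul1r.
  over.
rewrite [in X in _ = X -> _]big1 ?mul0r ?expR0; last by move=> i _; rewrite expr0n.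
rewrite (_ : 8%:R / 2 = 4%:R :> R); last by field.
rewrite powR_mulrn ?divr_ge0 ?(ltW pi0)// div1r.
set I := (X in (_ * X)%E) => E.
rewrite -[LHS]mul1e -[X in (X%:E * _)%E](_ : (2 * pi) ^+ 4 * (2 * pi)^-1 ^+ 4 = 1 :> R).
  by rewrite EFinM -muleA E mule1.
by rewrite -exprMn mulfV ?expr1n// gt_eqF.
Qed.

(** The exact value is 1.  The exponential loss is affordable because |z^p|^2
is at most 4^-|p| on the ball of radius 1/2. *)
Lemma fock_basis_norm_le p :
  fock (fock_basis p) (fock_basis p) <= 16 * 2 ^+ mpoly.mdeg p :> R.
Proof.
rewrite /fock; under eq_Rintegral do rewrite Re_mulconjc.
have le_int : (\int[leb 8]_t (normc (peval (fock_basis p) (C4_of_R8 t)) ^+ 2 *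
      expR (- enorm (C4_of_R8 t) ^+ 2))%:E <=
    (2 ^+ mpoly.mdeg p * (2 * pi) ^+ 4 : R)%:E)%E.
  rewrite [leRHS]EFinM -integral_leb8_gauss -ge0_integralZl//; last first.
    apply/measurable_EFinP.
    under eq_fun do rewrite enorm_C4_of_R8.
    apply: measurableT_comp => //; apply: measurableT_comp => //.
    apply: measurable_funM => //; apply: measurable_sum => i.
    apply: measurable_funX.
    exact: (@measurable_tnth _ (measurableTypeR R) 8 i).
  apply: ge0_le_integralT => t; rewrite -?EFinM ?lee_fin.
  - by rewrite mulr_ge0 ?sqr_ge0 ?expR_ge0.
  - by rewrite mulr_ge0 ?exprn_ge0 ?expR_ge0.
  - by rewrite normc_peval_fock_basis_le.
have int0 : ((0 : \bar R) <= \int[leb 8]_t (normc (peval (fock_basis p) (C4_of_R8 t)) ^+ 2 *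
      expR (- enorm (C4_of_R8 t) ^+ 2))%:E)%E.
  by apply: integral_ge0 => t _; rewrite lee_fin mulr_ge0 ?sqr_ge0 ?expR_ge0.
rewrite mulrC ler_pdivrMr ?exprn_gt0 ?pi_gt0//.
apply: (@le_trans _ _ (2 ^+ mpoly.mdeg p * (2 * pi) ^+ 4)); last first.
  rewrite exprMn le_eqVlt; apply/orP; left; apply/eqP.
  move: (pi : R) (2 ^+ mpoly.mdeg p) => x y; ring.
rewrite -lee_fin /Rintegral fineK// ge0_fin_numE//.
by apply: le_lt_trans le_int _; rewrite ltry.
Qed.

End Monomials.

(** * Power series on the ball of radius 1/2 *)

Section PowerSeries.
Context {R : realType}.
Implicit Types (p q : mindex) (c : mindex -> R).

Lemma sum_expr_le (r : R) m : 0 <= r < 1 -> \sum_(k < m) r ^+ k <= (1 - r)^-1.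
Proof.
move=> /andP[r0 r1]; have r1' : 0 < 1 - r by rewrite subr_gt0.
rewrite -[leRHS]mul1r ler_pdivlMr// mulrC -opprB mulNr -subrX1 opprB.
by rewrite gerBl exprn_ge0.
Qed.

(** A finite set of multi-indices lies in a box, over which the sum is the n-th
power of a partial geometric sum. *)
Lemma esum_exp_mdeg_le (n : nat) (r : R) : 0 <= r < 1 ->
  (\esum_(p in [set: mpoly.multinom n]) (r ^+ mpoly.mdeg p)%:E <=
   ((1 - r)^-1 ^+ n)%:E)%E.
Proof.
move=> r01; have /andP[r0 r1] := r01.
apply: ge_ereal_sup => _ [_ [/finite_seqP[s ->] _] <-].
have -> : [set` s] = [set` undup s].
  by apply/seteqP; split=> p /=; rewrite mem_undup.
rewrite -fsbig_seq ?undup_uniq// sumEFin lee_fin.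
pose m := (\max_(x <- s) mpoly.mdeg x)%N.
pose box (p : mpoly.multinom n) : {ffun 'I_n -> 'I_m.+1} :=
  [ffun i => inord (p i)].
have boxE (p : mpoly.multinom n) : p \in undup s -> forall i, box p i = p i :> nat.
  rewrite mem_undup => ps i; rewrite ffunE inordK// ltnS.
  apply: (@leq_trans (mpoly.mdeg p)); last exact: leq_bigmax_seq.
  by rewrite mpoly.mdegE (bigD1 i)//= leq_addr.
have box_inj : {in undup s &, injective box}.
  move=> p q ps qs pq; apply/mpoly.mnmP => i.
  by rewrite -boxE// pq boxE.
pose G (f : {ffun 'I_n -> 'I_m.+1}) := \prod_(i < n) r ^+ f i.
have G0 f : 0 <= G f by apply: prodr_ge0 => i _; exact: exprn_ge0.
have -> : \sum_(x <- undup s) r ^+ mpoly.mdeg x =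
    \sum_(f <- map box (undup s)) G f.
  rewrite big_map big_seq [RHS]big_seq; apply: eq_bigr => p ps.
  by rewrite mdegX; apply: eq_bigr => i _; rewrite boxE.
apply: (@le_trans _ _ (\sum_f G f)).
  rewrite big_uniq ?map_inj_in_uniq ?undup_uniq//.
  by rewrite [leRHS](bigID (mem (map box (undup s))))/= lerDl sumr_ge0.
rewrite /G -(bigA_distr_bigA (fun _ (k : 'I_m.+1) => r ^+ k)) prodr_const card_ord.
rewrite lerXn2r ?nnegrE ?sum_expr_le//.
  by apply: sumr_ge0 => k _; exact: exprn_ge0.
by rewrite invr_ge0 subr_ge0 ltW.
Qed.

Lemma esum_prod_bool (T : choiceType) (f : T * bool -> \bar R) :
  (forall k, 0 <= f k)%E ->
  \esum_(k in [set: T * bool]) f k =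
  (\esum_(x in [set: T]) (f (x, true) + f (x, false)))%E.
Proof.
move=> f0; have -> : [set: T * bool] = [set: T] `*`` (fun=> [set: bool]).
  by apply/seteqP; split.
transitivity (\esum_(k in [set: T] `*`` (fun=> [set: bool])) f (k.1, k.2)).
  by apply: eq_esum => -[].
rewrite -(@esum_esum _ _ _ [set: T] (fun=> [set: bool]) (fun x b => f (x, b)))//.
apply: eq_esum => x _.
rewrite esum_fset//; last exact: finite_finset.
rewrite (@fsbigE _ _ _ _ _ [:: true; false])//; last by case.
by rewrite !big_cons big_nil !in_setT /= addr0.
Qed.

Lemma normc_mmap1_le (z : 'I_4 -> R[i]) p : ball_half z ->
  normc (mpoly.mmap1 z p) <= 2^-1 ^+ mpoly.mdeg p.
Proof.
move=> z2; rewrite normc_mmap1 mdegX; apply: ler_prod => i _.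
rewrite exprn_ge0 ?normc_ge0//= lerXn2r ?nnegrE ?normc_ge0// ?invr_ge0//.
apply: le_trans (ltW z2).
rewrite -[leLHS]ger0_norm ?normc_ge0// -sqrtr_sqr ler_sqrt; last first.
  by apply: sumr_ge0 => j _; exact: sqr_ge0.
by rewrite (bigD1 i)//= lerDl; apply: sumr_ge0 => j _; exact: sqr_ge0.
Qed.

Let zeval c (z : 'I_4 -> R[i]) : \bar R :=
  \esum_(p in [set: mindex]) (`|c p| * normc (mpoly.mmap1 z p))%:E.

Let term_ge0 c (z : 'I_4 -> R[i]) p :
  (0 <= (`|c p| * normc (mpoly.mmap1 z p))%:E)%E.
Proof. by rewrite lee_fin mulr_ge0 ?normc_ge0. Qed.

Let zeval_ge0 c z : (0 <= zeval c z)%E.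
Proof. by apply: esum_ge0 => p _; exact: term_ge0. Qed.

Let zeval_le c z : ball_half z -> (zeval c z <= abs_norm c)%E.
Proof. by move=> z2; apply: ereal_sup_ubound; exists z. Qed.

Let ball0 : ball_half (fun=> 0 : R[i]).
Proof.
rewrite /ball_half /= /enorm big1 ?sqrtr0 ?invr_gt0// => i _.
by rewrite normc0 expr0n.
Qed.

Lemma abs_norm_ge0 c : (0 <= abs_norm c)%E.
Proof. exact: le_trans (zeval_ge0 _ _) (zeval_le _ ball0). Qed.

Lemma abs_norm_le c :
  (abs_norm c <=
   \esum_(p in [set: mindex]) (2^-1 ^+ mpoly.mdeg p * `|c p|)%:E)%E.
Proof.
apply: ge_ereal_sup => _ [z z2 <-]; apply: le_esum => p _.
by rewrite lee_fin mulrC ler_wpM2r// normc_mmap1_le.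
Qed.

Lemma abs_normD c d : (abs_norm (fun p => (c p + d p)%R) <=
  abs_norm c + abs_norm d)%E.
Proof.
apply: ge_ereal_sup => _ [z z2 <-].
apply: (@le_trans _ _ (zeval c z + zeval d z)%E); last first.
  by apply: leeD; exact: zeval_le.
rewrite -esumD//; apply: le_esum => p _.
by rewrite -EFinD lee_fin -mulrDl ler_wpM2r ?normc_ge0// ler_normD.
Qed.

Lemma abs_normZ (a : R) c :
  abs_norm (fun p => a * c p) = (`|a|%:E * abs_norm c)%E.
Proof.
rewrite /abs_norm -ereal_supZl//; last first.
  by apply/set0P; exists (zeval c (fun=> 0)), (fun=> 0).
rewrite image_comp; congr ereal_sup; apply: eq_imagel => z _ /=.
rewrite -esumZl//; apply: eq_esum => p _.
by rewrite normrM -mulrA EFinM.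
Qed.

(** All monomials are nonzero at (1/8, 1/8, 1/8, 1/8), a point of the ball. *)
Lemma abs_norm_eq0 c : abs_norm c = 0%E -> forall p, c p = 0.
Proof.
move=> c0 p; pose z (_ : 'I_4) : R[i] := Complex 8^-1 0.
have zE i : normc (z i) = 8^-1.
  by rewrite /= expr0n/= addr0 sqrtr_sqr ger0_norm.
have z2 : ball_half z.
  rewrite /ball_half /= /enorm (eq_bigr (fun=> 8^-1 ^+ 2)); last first.
    by move=> i _; rewrite zE.
  rewrite sumr_const card_ord.
  rewrite (_ : 8^-1 ^+ 2 *+ 4 = 4^-1 ^+ 2 :> R); last by rewrite -mulr_natr; field.
  by rewrite sqrtr_sqr ger0_norm// ltf_pV2 ?posrE// ltr_nat.
have w0 : 0 < normc (mpoly.mmap1 z p).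
  by rewrite normc_mmap1; apply: prodr_gt0 => i _; rewrite zE exprn_gt0// invr_gt0.
have : ((`|c p| * normc (mpoly.mmap1 z p))%:E <= 0)%E.
  rewrite -c0; apply: le_trans (zeval_le _ z2).
  apply: esum_ge; exists [set p]; first by split.
  by rewrite fsbig_set1.
by rewrite lee_fin pmulr_lle0// normr_le0 => /eqP.
Qed.

Lemma mfactD1 q :
  mfact (mpoly.mnm_add q (mpoly.mnm1 ord0)) = ((q ord0).+1 * mfact q)%N.
Proof.
rewrite /mfact (bigD1 ord0)//= [in RHS](bigD1 ord0)//= mpoly.mnmDE mpoly.mnm1E eqxx.
rewrite addn1 factS -mulnA; congr (_ * (_ * _))%N.
apply: eq_bigr => i i0; rewrite mpoly.mnmDE mpoly.mnm1E.
by rewrite eq_sym (negbTE i0) addn0.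
Qed.

Definition shift_up q : mindex := mpoly.mnm_add q (mpoly.mnm1 ord0).
Definition shift_down q : mindex := mpoly.mnm_sub q (mpoly.mnm1 ord0).

Lemma shift_downK q : q ord0 != 0%N -> shift_up (shift_down q) = q.
Proof. by move=> q0; apply: mpoly.submK; rewrite mpoly.lep1mP. Qed.

Lemma shift_upK q : shift_down (shift_up q) = q.
Proof. exact: mpoly.addmK. Qed.

(** This is sqrt (q_0 + 1) / 2, left in the form in which it comes out of the
normalisation of the monomials. *)
Definition up_coef q : R :=
  Num.sqrt (mfact q)%:R / Num.sqrt (mfact (shift_up q))%:R * ((q ord0).+1%:R / 2).

(** This is sqrt (q_0) / 2; the indicator matters when q_0 = 0, where
[shift_down] is truncated and fixes q. *)
Definition down_coef q : R :=
  Num.sqrt (mfact q)%:R / Num.sqrt (mfact (shift_down q))%:R *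
  ((q ord0 != 0%N)%:R / 2).

Lemma mcoeff_d0_monomial p q : mpoly.mcoeff q (d0_monomial p : pol4 R) =
  (p ord0)%:R / 2 * (shift_down p == q)%:R - 2^-1 * (shift_up p == q)%:R.
Proof. by rewrite mpoly.mcoeffB !mpoly.mcoeffZ !mpoly.mcoeffX. Qed.

Lemma shift_up0 q : shift_up q ord0 = (q ord0).+1.
Proof. by rewrite mpoly.mnmDE mpoly.mnm1E eqxx addn1. Qed.

Lemma shift_down0 q : shift_down q ord0 = (q ord0).-1.
Proof. by rewrite mpoly.mnmBE mpoly.mnm1E eqxx subn1. Qed.

(** Only the two neighbours of q in the direction z_0 have q in the image of
their monomial. *)
Lemma d0E c q :
  d0 c q = up_coef q * c (shift_up q) - down_coef q * c (shift_down q).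
Proof.
rewrite /d0 (@fsbigE _ _ _ _ _ [:: shift_up q; shift_down q])//=; last 2 first.
- rewrite andbT inE; apply/eqP => /(congr1 (fun p : mindex => p ord0)).
  rewrite shift_up0 shift_down0; case: (q ord0) => //= k /eqP.
  by rewrite eqn_leq ltnNge leqnSn.
- move=> p _; rewrite !inE negb_or => /andP[pu pd]; rewrite mcoeff_d0_monomial.
  rewrite [shift_up p == q](_ : _ = false); last first.
    by apply: contraNF pd => /eqP <-; rewrite shift_upK.
  rewrite mulr0 subr0; have [->|p0] := eqVneq (p ord0) 0%N.
    by rewrite !mul0r mulr0.
  rewrite [shift_down p == q](_ : _ = false) ?mulr0//.
  by apply: contraNF pu => /eqP <-; rewrite shift_downK.
rewrite !big_cons big_nil !in_setT /= addr0 !mcoeff_d0_monomial shift_upK eqxx mulr1 shift_up0.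
rewrite [shift_up (shift_up q) == q](_ : _ = false); last first.
  apply/eqP => /(congr1 (fun p : mindex => p ord0)) /eqP.
  by rewrite !shift_up0 eqn_leq ltnNge leqnSn.
have -> : (shift_up (shift_down q) == q) = (q ord0 != 0%N).
  apply/eqP/idP => [<-|]; last exact: shift_downK.
  by rewrite shift_up0.
have -> : (shift_down q ord0)%:R / 2 * (shift_down (shift_down q) == q)%:R = 0 :> R.
  rewrite shift_down0; have [->|q0] := eqVneq (q ord0) 0%N; first by rewrite !mul0r.
  rewrite [_ == q](_ : _ = false) ?mulr0//.
  apply/eqP => /(congr1 (fun p : mindex => p ord0)).
  rewrite !shift_down0; case: (q ord0) q0 => //= k _ /eqP.
  by rewrite eqn_leq [(k.+1 <= _)%N]ltnNge leq_pred andbF.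
rewrite mulr0 subr0 sub0r /up_coef /down_coef; ring.
Qed.

Lemma up_coef_bound q : 0 <= up_coef q <= (q ord0).+1%:R.
Proof.
rewrite /up_coef; set s := _ / Num.sqrt _.
have s0 : 0 <= s by rewrite divr_ge0 ?sqrtr_ge0.
have s1 : s <= 1.
  rewrite ler_pdivrMr ?mul1r ?sqrtr_gt0; last first.
    by rewrite ltr0n /mfact prodn_gt0// => i; exact: fact_gt0.
  by rewrite ler_wsqrtr// ler_nat /shift_up mfactD1 leq_pmull.
rewrite mulr_ge0 ?divr_ge0//=.
apply: le_trans (ler_piMl _ s1) _; first by rewrite divr_ge0.
by rewrite ler_pdivrMr// ler_peMr// ler1n.
Qed.

Lemma down_coef_bound q : 0 <= down_coef q <= (q ord0).+1%:R.
Proof.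
rewrite /down_coef; have [->|q0] := eqVneq (q ord0) 0%N.
  by rewrite mul0r mulr0 lexx ler0n.
rewrite mul1r mulr_ge0 ?divr_ge0 ?sqrtr_ge0//=.
rewrite -{1}(shift_downK q0) /shift_up mfactD1 natrM sqrtrM// mulfK; last first.
  rewrite gt_eqF// sqrtr_gt0 ltr0n /mfact prodn_gt0// => i; exact: fact_gt0.
rewrite -/(shift_down q) shift_down0 prednK ?lt0n//.
apply: (@le_trans _ _ (Num.sqrt (q ord0)%:R)).
  by rewrite ler_piMr ?sqrtr_ge0// invf_le1// ler1n.
rewrite -[leRHS]ger0_norm// -sqrtr_sqr ler_wsqrtr// -natrX ler_nat.
by apply: (leq_trans (leqnSn _)); rewrite expnS leq_pmulr// expn_gt0.
Qed.

End PowerSeries.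

(** * The norm of B_0 on the Fock space *)

Section FockNorm.
Context {R : realType} {H : completeNormedModType R} (dot : {dot H for idfun})
  (iota : {linear pol4 R -> H}).
Hypothesis hH : fock_completion dot iota.
Implicit Types (p q : mindex) (x y : H).

Let hilb : hilbert dot. Proof. by case: hH. Qed.

Lemma norm_fock_basis p :
  `|iota (fock_basis p)| <= 4 * (3 / 2) ^+ mpoly.mdeg p.
Proof.
rewrite -(ler_pXn2r (ltn0Sn 1)) ?nnegrE ?mulr_ge0 ?exprn_ge0 ?divr_ge0//.
have [_ dotE _] := hH.
rewrite hilb dotE; apply: le_trans (fock_basis_norm_le p) _.
rewrite exprMn (_ : 4 ^+ 2 = 16 :> R); last by ring.
rewrite ler_wpM2l// exprAC lerXn2r ?nnegrE ?exprn_ge0 ?divr_ge0//; lra.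
Qed.

Definition d0_vec q : H :=
  up_coef q *: iota (fock_basis (shift_up q)) -
  down_coef q *: iota (fock_basis (shift_down q)).

Lemma d0_coefs x q : d0 (coefs dot iota x) q = dot x (d0_vec q).
Proof. by rewrite d0E /d0_vec dotBr !dotZr. Qed.

(** Bernoulli's inequality; it absorbs the linear growth of the coefficients of
d_0 into a geometric rate. *)
Lemma expr_ge1Dn n : 1 + n%:R / 4 <= (5 / 4) ^+ n :> R.
Proof.
elim: n => [|n IH]; first by rewrite expr0 mul0r addr0.
rewrite exprS -[n.+1%:R]natr1; have := ler0n R n; nra.
Qed.

(** The two neighbours contribute 4 (3/2) = 6 and 4 times (3/2)^|q|, and their
coefficients are at most q_0 + 1 <= 4 (5/4)^|q|; thus 40 = 4 (6 + 4) and
15/8 = (5/4) (3/2). *)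
Lemma norm_d0_vec q : `|d0_vec q| <= 40 * (15 / 8) ^+ mpoly.mdeg q.
Proof.
set d := mpoly.mdeg q; set k : R := (q ord0).+1%:R.
have r0 m : 0 <= (3 / 2 : R) ^+ m by rewrite exprn_ge0 ?divr_ge0.
have up : `|up_coef q *: iota (fock_basis (shift_up q))| <=
    k * (6 * (3 / 2) ^+ d).
  have /andP[c0 ck] := up_coef_bound (R := R) q.
  rewrite normrZ ger0_norm//; apply: ler_pM => //.
  apply: le_trans (norm_fock_basis _) _.
  rewrite mpoly.mdegD mpoly.mdeg1 addn1 exprS le_eqVlt; apply/orP; left.
  by apply/eqP; field.
have down : `|down_coef q *: iota (fock_basis (shift_down q))| <=
    k * (4 * (3 / 2) ^+ d).
  have /andP[c0 ck] := down_coef_bound (R := R) q.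
  rewrite normrZ ger0_norm//; apply: ler_pM => //.
  apply: le_trans (norm_fock_basis _) _.
  rewrite ler_wpM2l// ler_weXn2l ?mpoly.mdegB//; lra.
have kd : k <= 4 * (5 / 4) ^+ d.
  apply: (@le_trans _ _ (4 * (5 / 4) ^+ q ord0)).
    have := expr_ge1Dn (q ord0); rewrite /k -[(q ord0).+1%:R]natr1; have := ler0n R (q ord0); lra.
  rewrite ler_wpM2l// ler_weXn2l//; first by lra.
  by rewrite /d mpoly.mdegE (bigD1 ord0)//= leq_addr.
apply: le_trans (ler_normB _ _) _; apply: le_trans (lerD up down) _.
rewrite -mulrDr -mulrDl (_ : 6 + 4 = 10 :> R); last by ring.
apply: (@le_trans _ _ (4 * (5 / 4) ^+ d * (10 * (3 / 2) ^+ d))).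
  by rewrite ler_wpM2r// mulr_ge0.
rewrite mulrACA -exprMn le_eqVlt; apply/orP; left; apply/eqP.
by congr (_ * _ ^+ _); field.
Qed.

(** The factor 2^-|p| is the size of z^p on the ball of radius 1/2; the boolean
tells the functionals coming from d_0 x from those coming from x. *)
Definition weighted_vec (k : mindex * bool) : H :=
  2^-1 ^+ mpoly.mdeg k.1 *:
  (if k.2 then d0_vec k.1 else iota (fock_basis k.1)).

Lemma norm_weighted_vec k :
  `|weighted_vec k| <= 40 * (15 / 16) ^+ mpoly.mdeg k.1.
Proof.
case: k => p b; rewrite /weighted_vec /=; set v := (if b then _ else _).
have vle : `|v| <= 40 * (15 / 8) ^+ mpoly.mdeg p.
  rewrite /v; case: b {v}; first exact: norm_d0_vec.
  apply: le_trans (norm_fock_basis _) _.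
  apply: ler_pM; rewrite ?exprn_ge0 ?divr_ge0//; first by lra.
  rewrite lerXn2r ?nnegrE ?divr_ge0//; lra.
rewrite normrZ ger0_norm ?exprn_ge0 ?invr_ge0//.
apply: le_trans (ler_wpM2l _ vle) _; first by rewrite exprn_ge0 ?invr_ge0.
rewrite mulrCA -exprMn le_eqVlt; apply/orP; left; apply/eqP.
by congr (_ * _ ^+ _); field.
Qed.

Lemma weighted_vec_summable :
  (\esum_(k in [set: mindex * bool]) (`|weighted_vec k|)%:E < +oo)%E.
Proof.
apply: (@le_lt_trans _ _
    (80%:E * \esum_(p in [set: mindex]) ((15 / 16) ^+ mpoly.mdeg p)%:E)%E).
  rewrite -esumZl//.
  rewrite esum_prod_bool//; apply: le_esum => p _.
  rewrite -EFinD -EFinM lee_fin.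
  have := norm_weighted_vec (p, true); have := norm_weighted_vec (p, false).
  by rewrite /=; lra.
rewrite lte_mul_pinfty//.
apply: le_lt_trans (esum_exp_mdeg_le _ _) _; last by rewrite ltry.
by apply/andP; split; lra.
Qed.

Lemma B0_norm_le x : (B0_norm (coefs dot iota x) <=
  \esum_(k in [set: mindex * bool]) (`|dot x (weighted_vec k)|)%:E)%E.
Proof.
rewrite esum_prod_bool// esumD// addeC; apply: leeD.
  apply: le_trans (abs_norm_le _) _; apply: le_esum => p _.
  by rewrite dotZr normrM ger0_norm ?exprn_ge0 ?invr_ge0.
apply: le_trans (abs_norm_le _) _; apply: le_esum => p _.
by rewrite d0_coefs dotZr normrM ger0_norm ?exprn_ge0 ?invr_ge0.
Qed.

Lemma B0_norm_lty x : (B0_norm (coefs dot iota x) < +oo)%E.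
Proof.
apply: le_lt_trans (B0_norm_le x) _.
apply: (@le_lt_trans _ _ (`|x|%:E *
    \esum_(k in [set: mindex * bool]) (`|weighted_vec k|)%:E)%E).
  rewrite -esumZl//; apply: le_esum => k _.
  by rewrite -EFinM lee_fin cauchy_schwarz.
by rewrite lte_mul_pinfty// weighted_vec_summable.
Qed.

(** Such an x is orthogonal to all polynomials, and some polynomial is closer
to x than 0 is. *)
Lemma coefs_eq0 x : (forall p, coefs dot iota x p = 0) -> x = 0.
Proof.
move=> x0; have [_ _ dns] := hH.
have ortho f : dot x (iota f) = 0.
  rewrite (mpoly.mpolyE f) !linear_sum/= big1// => m _.
  rewrite linearZ/= dotZr.
  suff -> : iota (mpoly.mpolyX R m) =
      Num.sqrt (mfact m)%:R *: iota (fock_basis m).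
    by rewrite dotZr [dot _ _]x0 !mulr0.
  rewrite linearZ/= scalerA mulfV ?scale1r// gt_eqF// sqrtr_gt0 ltr0n.
  by rewrite /mfact prodn_gt0// => i; exact: fact_gt0.
apply/eqP; apply/negPn/negP => xN0.
have nx0 : 0 < `|x| by rewrite normr_gt0.
have [y [xf [f _ fy]]] : (ball x `|x|)^° `&` range iota !=set0.
  apply: dns; last exact: open_interior.
  by exists x; exact: nbhsx_ballx.
have {}xf : `|x - iota f| < `|x|.
  by have := interior_subset xf; rewrite -fy -ball_normE.
have : `|x| ^+ 2 <= `|x| * `|x - iota f|.
  rewrite hilb -[leLHS]subr0 -(ortho f) -dotBr.
  exact: le_trans (ler_norm _) (cauchy_schwarz hilb _ _).
by rewrite expr2 ler_pM2l// leNgt xf.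
Qed.

Lemma abs_norm_cst0 : abs_norm (fun=> 0 : R) = 0%E.
Proof.
have := abs_normZ 0 (fun=> 0 : R); rewrite normr0 mul0e.
by under eq_fun do rewrite mul0r.
Qed.

Lemma B0_norm_is_norm : is_norm (fun x => B0_norm (coefs dot iota x)).
Proof.
have d0_fun x : d0 (coefs dot iota x) = fun q => dot x (d0_vec q).
  by apply/funext => q; exact: d0_coefs.
split.
- by move=> x; rewrite B0_norm_lty adde_ge0 ?abs_norm_ge0.
- move=> x /eqP; rewrite padde_eq0 ?abs_norm_ge0// => /andP[/eqP x0 _].
  by apply: coefs_eq0; exact: abs_norm_eq0.
- move=> a x; rewrite /B0_norm !d0_fun ge0_muleDr ?abs_norm_ge0// -!abs_normZ.
  by congr (abs_norm _ + abs_norm _)%E; apply/funext => q; exact: dotZl.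
- move=> x y; rewrite /B0_norm !d0_fun addeACA; apply: leeD.
    rewrite (_ : coefs dot iota _ =
      fun p => coefs dot iota x p + coefs dot iota y p) ?abs_normD//.
    by apply/funext => p; exact: dotDl.
  under eq_fun do rewrite dotDl.
  exact: abs_normD.
Qed.

Lemma coefs_in_B0 x : in_B0 dot iota (coefs dot iota x).
Proof.
have sub0 : (coefs dot iota x \- coefs dot iota x)%R = (fun=> 0).
  by apply/funext => p /=; rewrite subrr.
move=> eps eps0; exists (coefs dot iota x); split.
- move=> d d0; exists x; rewrite sub0 abs_norm_cst0 lte_fin//.
- apply: le_lt_trans (B0_norm_lty x).
  by rewrite /B0_norm leeDr// abs_norm_ge0.
- rewrite sub0 /B0_norm (_ : d0 _ = fun=> 0) ?abs_norm_cst0 ?adde0 ?lte_fin//.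
  by apply/funext => q; rewrite d0E !mulr0 subrr.
Qed.

End FockNorm.

Theorem proposition5p5 (R : realType) (H : completeNormedModType R)
    (dot : {dot H for idfun}) (iota : {linear pol4 R -> H})
    (hH : fock_completion dot iota) (theta : R) (htheta : 0 < theta) :
  (forall x : H, in_B0 dot iota (coefs dot iota x)) /\
  measurable_norm dot theta (fun x : H => B0_norm (coefs dot iota x)).
Proof.
split; first by move=> x; exact: coefs_in_B0.
split; first exact: B0_norm_is_norm.
have [hilb _ _] := hH.
exact: (gross_of_summable hilb htheta (weighted_vec_summable hH)
  (B0_norm_le dot iota)).
Qed.
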